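(* Let $n\ge1$. The map sending a positive integral frieze $F$ on the annulus $A_{n,n}$ to the family $u_{i,j}=F(\gamma_{i,j})$, $i,j\in\mathbb Z$, is a bijection between positive integral friezes on $A_{n,n}$ and positive integral $n$-periodic bi-infinite quasi-friezes.
   Context: A bi-infinite quasi-frieze (BiQF) is a family $(u_{i,j})_{i,j\in\mathbb Z}$ of real numbers (arranged in a diamond grid) satisfying the quasi-diamond rule $u_{i,j}u_{i+1,j+1}-u_{i,j+1}u_{i+1,j}=-1$ for all $i,j$. It is positive integral if all entries are positive integers, and $n$-periodic if $u_{i+n,j+n}=u_{i,j}$ for all $i,j$. $A_{n,n}$ is an annulus with marked points $P_1,\dots,P_n$ on one boundary component and $Q_1,\dots,Q_n$ on the other. An arc is a non-contractible simple curve with endpoints at marked points, up to isotopy; boundary segments between consecutive marked points are arcs too. A quadrilateral $ABCD$ is a collection of pairwise non-crossing arcs $AB,BC,CD,DA$ cutting out a disc with vertices in this cyclic order. A positive integral frieze on $A_{n,n}$ assigns a positive integer $F(\gamma)$ to every arc, with $F=1$ on boundary segments and $F(AC)F(BD)=F(AB)F(CD)+F(BC)F(AD)$ for all quadrilaterals $ABCD$. In the universal cover (an infinite strip) marked points lift to $\hat P_i$, $\hat Q_j$ ($i,j\in\mathbb Z$) on the two boundary lines, $\hat P_i$ over $P_{i'}$ with $i'\equiv i\pmod n$, $\hat Q_j$ over $Q_{j'}$ with $j'\equiv j\pmod n$, deck generator $\hat P_i\mapsto\hat P_{i+n}$, $\hat Q_j\mapsto\hat Q_{j+n}$, labels chosen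 so that $\hat P_i,\hat P_{i+1},\hat Q_{j+1},\hat Q_j$ form a quadrilateral in this cyclic order. $\gamma_{i,j}$ is the bridging arc that is the image of the segment $\hat P_i\hat Q_j$. *)

(* Defs.v *)
From HB Require Import structures.
From mathcomp Require Import all_boot all_order all_algebra.
From mathcomp Require Import zify.
From mathcomp Require Import all_classical all_reals.

Set Implicit Arguments.
Unset Strict Implicit.
Unset Printing Implicit Defensive.

Import Order.TTheory GRing.Theory Num.Theory.
Local Open Scope classical_set_scope.
Local Open Scope ring_scope.

(** Bi-infinite quasi-friezes. *)

Definition quasi_frieze (R : realType) (u : int -> int -> R) : Prop :=
  forall i j : int,
    u i j * u (i + 1) (j + 1) - u i (j + 1) * u (i + 1) j = -1.

Definition positive_integral (R : realType) (u : int -> int -> R) : Prop :=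
  forall i j : int, u i j \is a Num.int /\ 0 < u i j.

Definition periodic (R : realType) (n : nat) (u : int -> int -> R) : Prop :=
  forall i j : int, u (i + n%:Z) (j + n%:Z) = u i j.

(** The annulus A_{n,n} is handled through its universal cover, an infinite
    strip, i.e. a closed disc minus two boundary points.  A homotopy class of
    curves between marked points of the annulus is a deck orbit of pairs of
    lifted marked points (joined by a segment of the strip), and two such
    segments, in minimal position, cross iff their endpoints are interlaced on
    the boundary of the disc. *)

Inductive lpoint := hatP of int | hatQ of int.

(* The boundary of the strip, cut open at its left end: first the line of the
   P's from left to right, then the line of the Q's from right to left. *)
Definition before (a b : lpoint) : bool :=
  match a, b with
  | hatP i, hatP j => i < j
  | hatP _, hatQ _ => true
  | hatQ _, hatP _ => false
  | hatQ i, hatQ j => j < i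
  end.

Definition cyclic3 (a b c : lpoint) : bool :=
  [|| before a b && before b c, before b c && before c a
    | before c a && before a b].

Definition cyclic4 (a b c d : lpoint) : bool := cyclic3 a b c && cyclic3 a c d.

Definition seg_cross (e f : lpoint * lpoint) : bool :=
  cyclic4 e.1 f.1 e.2 f.2 || cyclic4 e.1 f.2 e.2 f.1.

(* The k-th power of the deck generator. *)
Definition deck (n : nat) (k : int) (a : lpoint) : lpoint :=
  match a with
  | hatP i => hatP (i + k * n%:Z)
  | hatQ j => hatQ (j + k * n%:Z)
  end.

(* The segment ab projects to a non-contractible curve (a <> b) which is simple
   (no lift of it crosses ab). *)
Definition arc_lift (n : nat) (a b : lpoint) : Prop :=
  a <> b /\ forall k : int, ~~ seg_cross (a, b) (deck n k a, deck n k b).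

(* All lifts of the image of ab, each taken with both orientations. *)
Definition all_lifts (n : nat) (a b : lpoint) : set (lpoint * lpoint) :=
  [set e | exists k : int, e = (deck n k a, deck n k b)
                        \/ e = (deck n k b, deck n k a)].

(* An isotopy class of arcs of A_{n,n} is identified with the set of its
   lifts. *)
Record annulus_arc (n : nat) := Arc {
  lifts :> set (lpoint * lpoint);
  arcP : exists a b : lpoint, arc_lift n a b /\ lifts = all_lifts n a b }.

Definition arcs_cross (n : nat) (g h : annulus_arc n) : Prop :=
  exists e f : lpoint * lpoint, [/\ lifts g e, lifts h f & seg_cross e f].

Definition boundary_segment (n : nat) (g : annulus_arc n) : Prop :=
  exists i : int,
    lifts g (hatP i, hatP (i + 1)) \/ lifts g (hatQ i, hatQ (i + 1)).

(* A disc cut out by four arcs lifts to the strip, so that its vertices become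
   four distinct points A, B, C, D in cyclic order; they may coincide in the
   annulus.  Conversely, as the sides do not cross, the region bounded by the
   segments AB, BC, CD, DA has its interior disjoint from its translates, hence
   embeds.  Fixing the orientation is harmless: the exchange relation is
   invariant under reversal of ABCD. *)
Definition quadrilateral (n : nat) (A B C D : lpoint)
    (AB BC CD DA : annulus_arc n) : Prop :=
  [/\ cyclic4 A B C D,
      [/\ lifts AB (A, B), lifts BC (B, C), lifts CD (C, D) & lifts DA (D, A)]
    & [/\ ~ arcs_cross AB BC, ~ arcs_cross AB CD & ~ arcs_cross AB DA] /\
      [/\ ~ arcs_cross BC CD, ~ arcs_cross BC DA & ~ arcs_cross CD DA]].

(* The diagonals AC and BD of a quadrilateral always exist as arcs, see
   [quadrilateral_diagonals] below. *)
Definition positive_integral_frieze (n : nat) (F : annulus_arc n -> int) : Prop :=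
  [/\ forall g : annulus_arc n, 0 < F g,
      forall g : annulus_arc n, boundary_segment g -> F g = 1
    & forall (A B C D : lpoint) (AB BC CD DA AC BD : annulus_arc n),
        quadrilateral A B C D AB BC CD DA ->
        lifts AC (A, C) -> lifts BD (B, D) ->
        F AC * F BD = F AB * F CD + F BC * F DA].

Lemma bridging_arc_lift (n : nat) (i j : int) : arc_lift n (hatP i) (hatQ j).
Proof.
split=> // k; rewrite /seg_cross /cyclic4 /cyclic3 /=.
by move: (k * n%:Z) => t; lia.
Qed.

Definition bridging_arc (n : nat) (i j : int) : annulus_arc n :=
  Arc (ex_intro _ (hatP i) (ex_intro _ (hatQ j)
        (conj (bridging_arc_lift n i j) erefl))).

Definition bridging_family (R : realType) (n : nat) (F : annulus_arc n -> int) :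
    int -> int -> R :=
  fun i j => (F (bridging_arc n i j))%:~R.

(** Sanity checks on the model of arcs. *)

Lemma arc_liftP (n : nat) (a b : lpoint) : (0 < n)%N ->
  arc_lift n a b <->
  match a, b with
  | hatP i, hatP j | hatQ i, hatQ j => [&& i != j, i <= j + n%:Z & j <= i + n%:Z]
  | _, _ => true
  end.
Proof.
move=> n0; split.
  case: a b => i [] j // [ab noX]; have := noX 1; have := noX (-1);
  have ij : i <> j by [move=> E; apply: ab; rewrite E];
  by rewrite /seg_cross /cyclic4 /cyclic3 /=; lia.
have big k : k = 0 \/ (n%:Z <= k * n%:Z) \/ (k * n%:Z <= - n%:Z) :> Prop.
  have [->|[]] : k = 0 \/ (1 <= k \/ k <= -1) by lia.
  - by left.
  - by move=> ?; right; left; nia.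
  - by move=> ?; right; right; nia.
case: a b => i [] j /= H; (split=> [|k]; first by move=> E; inversion E; lia);
  rewrite /seg_cross /cyclic4 /cyclic3 /=;
  (case: (big k) => [->|]; first by lia);
  by move: (k * n%:Z) => t; lia.
Qed.

Lemma bridging_arc_eqP (n : nat) (i j i' j' : int) :
  bridging_arc n i j = bridging_arc n i' j' <->
  exists k : int, i' = i + k * n%:Z /\ j' = j + k * n%:Z.
Proof.
split=> [/(congr1 (@lifts n)) /= E|[k [-> ->]]].
  have: all_lifts n (hatP i') (hatQ j') (hatP i', hatQ j').
    by exists 0; left; rewrite /= !mul0r !addr0.
  by rewrite -E => -[k [[-> ->]|//]]; exists k.
suff E : all_lifts n (hatP i) (hatQ j)
       = all_lifts n (hatP (i + k * n%:Z)) (hatQ (j + k * n%:Z)).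
  rewrite /bridging_arc; move: (ex_intro _ _ _) (ex_intro _ _ _).
  by rewrite -E => p q; rewrite (Prop_irrelevance p q).
apply/seteqP; split=> e -[l /= el].
  exists (l - k); rewrite /= -!addrA -!mulrDl.
  by rewrite [k + _]addrC subrK.
by exists (k + l); rewrite /= !mulrDl !addrA.
Qed.

Lemma lifts_arc_lift (n : nat) (g : annulus_arc n) (a b : lpoint) : (0 < n)%N ->
  lifts g (a, b) -> arc_lift n a b.
Proof.
move=> n0; have [x [y [xy ->]]] := arcP g; move=> [k E]; apply/arc_liftP => //.
move/(arc_liftP _ _ n0): xy.
by case: x y E => i [] j [] [-> ->] //=; lia.
Qed.

Lemma lifts_deck (n : nat) (g : annulus_arc n) (a b : lpoint) (k : int) :
  lifts g (a, b) -> lifts g (deck n k a, deck n k b).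
Proof.
have [x [y [_ ->]]] := arcP g; move=> [l E]; exists (l + k).
by case: x y E => i [] j [] [-> ->] /=; rewrite !mulrDl !addrA; auto.
Qed.

Lemma triangle_arc_lift (n : nat) (a c d : lpoint) : (0 < n)%N ->
  before a c -> cyclic3 a c d -> arc_lift n c d -> arc_lift n d a ->
  (forall k, ~~ seg_cross (c, d) (deck n k d, deck n k a)) -> arc_lift n a c.
Proof.
move=> n0 ac acd /(arc_liftP _ _ n0) cd /(arc_liftP _ _ n0) da noX.
apply/(arc_liftP _ _ n0); move: ac acd cd da (noX 1) (noX (-1)).
rewrite /seg_cross /cyclic4 /cyclic3.
by case: a c d {noX} => a [] c [] d //=; lia.
Qed.

Lemma quadrilateral_diagonals (n : nat) (A B C D : lpoint)
    (AB BC CD DA : annulus_arc n) : (0 < n)%N -> quadrilateral A B C D AB BC CD DA ->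
  arc_lift n A C /\ arc_lift n B D.
Proof.
move=> n0 [cyc [lAB lBC lCD lDA] [[nABBC _ nABDA] [nBCCD _ nCDDA]]].
have noX (g h : annulus_arc n) a b c d : ~ arcs_cross g h -> lifts g (a, b) ->
    lifts h (c, d) -> forall k, ~~ seg_cross (a, b) (deck n k c, deck n k d).
  move=> gh ga hc k; apply/negP => X; apply: gh.
  by exists (a, b), (deck n k c, deck n k d); split=> //; apply: lifts_deck.
have arc_liftC x y : arc_lift n x y -> arc_lift n y x.
  move=> /(arc_liftP _ _ n0) xy; apply/(arc_liftP _ _ n0).
  by case: x y xy => i [] j //=; lia.
have seg_crossC e f : seg_cross e f -> seg_cross f e.
  rewrite /seg_cross /cyclic4 /cyclic3.
  by case: e f => [[] ? [] ?] [[] ? [] ?] /=; lia.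
have nDAAB : ~ arcs_cross DA AB.
  move=> [e [f [? ? X]]]; apply: nABDA; exists f, e; split=> //.
  exact: seg_crossC.
have total x y z : cyclic3 x y z -> before x y || before y x.
  by rewrite /cyclic3; case: x y z => x [] y [] z //=; lia.
have [ABC ACD BCD BDA] : [/\ cyclic3 A B C, cyclic3 A C D, cyclic3 B C D
    & cyclic3 B D A].
  move: cyc; rewrite /cyclic4 => /andP[ABC ACD]; split=> //;
  move: ABC ACD; rewrite /cyclic3;
  by case: A B C D {lAB lBC lCD lDA} => a [] b [] c [] d //=; lia.
have rot x y z : cyclic3 x y z -> cyclic3 y z x.
  by rewrite /cyclic3 => /or3P[] ->; rewrite ?orbT.
have arcl (g : annulus_arc n) x y : lifts g (x, y) -> arc_lift n x y.
  exact: lifts_arc_lift.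
split.
- have /orP[AC|CA] := total _ _ _ ACD.
    exact: (triangle_arc_lift n0 AC ACD (arcl _ _ _ lCD) (arcl _ _ _ lDA)
      (noX _ _ _ _ _ _ nCDDA lCD lDA)).
  apply: arc_liftC.
  exact: (triangle_arc_lift n0 CA (rot _ _ _ (rot _ _ _ ABC))
    (arcl _ _ _ lAB) (arcl _ _ _ lBC) (noX _ _ _ _ _ _ nABBC lAB lBC)).
- have /orP[BD|DB] := total _ _ _ BDA.
    exact: (triangle_arc_lift n0 BD BDA (arcl _ _ _ lDA) (arcl _ _ _ lAB)
      (noX _ _ _ _ _ _ nDAAB lDA lAB)).
  apply: arc_liftC.
  exact: (triangle_arc_lift n0 DB (rot _ _ _ (rot _ _ _ BCD))
    (arcl _ _ _ lBC) (arcl _ _ _ lCD) (noX _ _ _ _ _ _ nBCCD lBC lCD)).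
Qed.

(* Main.v *)
Require Import Defs.
From mathcomp Require Import all_boot all_order all_algebra.
From mathcomp Require Import zify ring.
From mathcomp Require Import all_classical all_reals.

Set Implicit Arguments.
Unset Strict Implicit.
Unset Printing Implicit Defensive.

Import Order.TTheory GRing.Theory Num.Theory.
Local Open Scope classical_set_scope.
Local Open Scope ring_scope.

(** A quadrilateral with two bridging sides, one boundary side and one side on
    the other boundary expresses the value of a frieze on a peripheral arc as a
    2x2 minor of u; this gives the quasi-diamond rule and injectivity.
    Conversely, a positive quasi-frieze satisfies three-term linear recurrences
    along rows and along columns, hence has rank two: there are integral plane
    vectors v_a, one for every lifted marked point a, with
    u_{i,j} = det (v_{P_i}, v_{Q_j}).  The minors of two adjacent columns do not
    depend on the columns and are the determinants det (v_{P_i}, v_{P_j}), and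
    likewise for rows, so |det (v_a, v_b)| is invariant under the deck group.
    As det (v_a, v_b) > 0 whenever a comes before b on the boundary of the strip,
    the exchange relations are the Pluecker relations. *)

(** * Arcs and their lifts *)

Section Arcs.
Variable n : nat.
Implicit Types (g h : annulus_arc n) (a b c d : lpoint).

Lemma deckD k l a : deck n k (deck n l a) = deck n (l + k) a.
Proof. by case: a => i /=; rewrite mulrDl addrA. Qed.

Lemma deck0 a : deck n 0 a = a.
Proof. by case: a => i /=; rewrite mul0r addr0. Qed.

Lemma lifts_sym g a b : lifts g (a, b) -> lifts g (b, a).
Proof.
have [x [y [_ ->]]] := arcP g.
by move=> [k [[-> ->]|[-> ->]]]; exists k; [right|left].
Qed.

Lemma liftsE g a b : lifts g (a, b) -> lifts g = all_lifts n a b.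
Proof.
have [x [y [_ ->]]] := arcP g.
move=> [k E]; apply/seteqP; split=> e [l el].
  exists (l - k).
  by case: E el => -[-> ->] -[] ->; rewrite !deckD [k + _]addrC subrK; auto.
exists (k + l).
by case: E el => -[-> ->] -[] ->; rewrite !deckD; auto.
Qed.

Lemma arc_has_lift g : exists e, lifts g e.
Proof.
have [a [b [_ ->]]] := arcP g.
by exists (a, b), 0; left; rewrite !deck0.
Qed.

Lemma lifts_inj g h a b : lifts g (a, b) -> lifts h (a, b) -> g = h.
Proof.
move=> /liftsE gE /liftsE; rewrite -gE.
case: g h {gE} => [s p] [t q] /= ts; case: s / ts p => p.
by congr Arc; exact: Prop_irrelevance.
Qed.

Lemma lifts_bridging_arc i j : lifts (bridging_arc n i j) (hatP i, hatQ j).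
Proof. by exists 0; left; rewrite !deck0. Qed.

Lemma seg_cross_deck k a b c d :
  seg_cross (deck n k a, deck n k b) (deck n k c, deck n k d)
  = seg_cross (a, b) (c, d).
Proof.
rewrite /seg_cross /cyclic4 /cyclic3 /=.
have E x y : before (deck n k x) (deck n k y) = before x y.
  by case: x y => i [] j //=; rewrite ltrD2r.
by rewrite !E.
Qed.

Lemma seg_cross_swapl a b c d :
  seg_cross (b, a) (c, d) = seg_cross (a, b) (c, d).
Proof.
rewrite /seg_cross /cyclic4 /cyclic3 /=.
by case: a b c d => a [] b [] c [] d /=; lia.
Qed.

Lemma seg_cross_swapr a b c d :
  seg_cross (a, b) (d, c) = seg_cross (a, b) (c, d).
Proof. by rewrite /seg_cross /= orbC. Qed.

(** [seg_cross] is unchanged by a common deck translation and by reversing either segment, so one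
    lift of each arc and their relative shift [k] suffice. *)
Lemma arcs_not_cross g h a b c d : lifts g (a, b) -> lifts h (c, d) ->
  (forall k, ~~ seg_cross (a, b) (deck n k c, deck n k d)) -> ~ arcs_cross g h.
Proof.
move=> /liftsE gE /liftsE hE noX [e [f []]]; rewrite gE hE.
move=> [k ek] [l fl] X; have /negP := noX (l - k); apply.
rewrite -(seg_cross_deck k) !deckD subrK.
case: ek fl X => -> [] -> //.
- by rewrite seg_cross_swapr.
- by rewrite seg_cross_swapl.
- by rewrite seg_cross_swapl seg_cross_swapr.
Qed.

(** The linear facts about the product [k * n] that decide whether a translate can cross, given that
    peripheral arcs span at most [n]. *)
Lemma deck_shift k :
  [\/ k * n%:Z = 0, n%:Z <= k * n%:Z | k * n%:Z <= - n%:Z].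
Proof.
have [->|[]] : k = 0 \/ (1 <= k \/ k <= -1) by lia.
- by rewrite mul0r; constructor 1.
- by move=> ?; constructor 2; nia.
- by move=> ?; constructor 3; nia.
Qed.

Hypothesis n_gt0 : (0 < n)%N.

Lemma boundaryP_arc_lift i : arc_lift n (hatP i) (hatP (i + 1)).
Proof. by apply/arc_liftP => //; lia. Qed.

Lemma boundaryQ_arc_lift i : arc_lift n (hatQ i) (hatQ (i + 1)).
Proof. by apply/arc_liftP => //; lia. Qed.

Definition boundaryP i : annulus_arc n :=
  Arc (ex_intro _ _ (ex_intro _ _ (conj (boundaryP_arc_lift i) erefl))).

Definition boundaryQ i : annulus_arc n :=
  Arc (ex_intro _ _ (ex_intro _ _ (conj (boundaryQ_arc_lift i) erefl))).

Lemma lifts_boundaryP i : lifts (boundaryP i) (hatP i, hatP (i + 1)).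
Proof. by exists 0; left; rewrite !deck0. Qed.

Lemma lifts_boundaryQ i : lifts (boundaryQ i) (hatQ i, hatQ (i + 1)).
Proof. by exists 0; left; rewrite !deck0. Qed.

(** * Peripheral arcs as minors *)

(** Since [j <= i + n] and [l <= k + n], no deck translate of a bridging endpoint lies strictly
    between [i] and [j] or between [k] and [l], and translates of the two bridging sides are weakly
    ordered the same way on both lines. *)
Lemma bridged_quadrilateral (g h : annulus_arc n) i j k l : i < j -> k < l ->
  lifts g (hatP i, hatP j) -> lifts h (hatQ k, hatQ l) ->
  quadrilateral (hatP i) (hatP j) (hatQ l) (hatQ k)
    g (bridging_arc n j l) h (bridging_arc n i k).
Proof.
move=> ij kl gij hkl.
have /(arc_liftP _ _ n_gt0) /= gn := lifts_arc_lift n_gt0 gij.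
have /(arc_liftP _ _ n_gt0) /= hn := lifts_arc_lift n_gt0 hkl.
have lh := lifts_sym hkl.
have ljl := lifts_bridging_arc j l.
have lki := lifts_sym (lifts_bridging_arc i k).
split=> //; first by rewrite /cyclic4 /cyclic3 /=; lia.
split; split.
- apply: (arcs_not_cross gij ljl) => m; rewrite /seg_cross /cyclic4 /cyclic3 /=.
  by case: (deck_shift m); move: (m * n%:Z) => t; lia.
- apply: (arcs_not_cross gij lh) => m; rewrite /seg_cross /cyclic4 /cyclic3 /=.
  by case: (deck_shift m); move: (m * n%:Z) => t; lia.
- apply: (arcs_not_cross gij lki) => m; rewrite /seg_cross /cyclic4 /cyclic3 /=.
  by case: (deck_shift m); move: (m * n%:Z) => t; lia.
- apply: (arcs_not_cross ljl lh) => m; rewrite /seg_cross /cyclic4 /cyclic3 /=.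
  by case: (deck_shift m); move: (m * n%:Z) => t; lia.
- apply: (arcs_not_cross ljl lki) => m; rewrite /seg_cross /cyclic4 /cyclic3 /=.
  by case: (deck_shift m); move: (m * n%:Z) => t; lia.
- apply: (arcs_not_cross lh lki) => m; rewrite /seg_cross /cyclic4 /cyclic3 /=.
  by case: (deck_shift m); move: (m * n%:Z) => t; lia.
Qed.

Section Frieze.
Variable F : annulus_arc n -> int.
Hypothesis friezeF : positive_integral_frieze F.
Local Notation u i j := (F (bridging_arc n i j)).

Lemma frieze_peripheral_product (g h : annulus_arc n) i j k l :
    i < j -> k < l ->
    lifts g (hatP i, hatP j) -> lifts h (hatQ k, hatQ l) ->
  F g * F h = u i l * u j k - u j l * u i k.
Proof.
move=> ij kl gij hkl; have [_ _ ptolemy] := friezeF.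
rewrite (ptolemy _ _ _ _ _ _ _ _ _ _
  (bridged_quadrilateral ij kl gij hkl) (lifts_bridging_arc i l)
  (lifts_bridging_arc j k)).
by rewrite addrK.
Qed.

Lemma frieze_boundaryP i : F (boundaryP i) = 1.
Proof.
have [_ bd _] := friezeF; apply: bd; exists i; left.
exact: lifts_boundaryP.
Qed.

Lemma frieze_boundaryQ i : F (boundaryQ i) = 1.
Proof.
have [_ bd _] := friezeF; apply: bd; exists i; right.
exact: lifts_boundaryQ.
Qed.

Lemma frieze_peripheralP (g : annulus_arc n) i j : i < j ->
    lifts g (hatP i, hatP j) ->
  F g = u i 1 * u j 0 - u j 1 * u i 0.
Proof.
move=> ij gij.
have := frieze_peripheral_product ij ltr01 gij (lifts_boundaryQ 0).
by rewrite frieze_boundaryQ mulr1.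
Qed.

Lemma frieze_peripheralQ (h : annulus_arc n) k l : k < l ->
    lifts h (hatQ k, hatQ l) ->
  F h = u 0 l * u 1 k - u 1 l * u 0 k.
Proof.
move=> kl hkl.
have := frieze_peripheral_product ltr01 kl (lifts_boundaryP 0) hkl.
by rewrite frieze_boundaryP mul1r.
Qed.

Lemma frieze_diamond i j :
  u i (j + 1) * u (i + 1) j - u (i + 1) (j + 1) * u i j = 1.
Proof.
rewrite -(frieze_peripheral_product _ _ (lifts_boundaryP i) (lifts_boundaryQ j)).
- by rewrite frieze_boundaryP frieze_boundaryQ.
- by rewrite ltrDl.
- by rewrite ltrDl.
Qed.

End Frieze.

(** * Reconstruction of a frieze from its bridging values *)

Lemma frieze_inj (F G : annulus_arc n -> int) :
    positive_integral_frieze F -> positive_integral_frieze G ->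
    (forall i j, F (bridging_arc n i j) = G (bridging_arc n i j)) ->
  F = G.
Proof.
move=> frF frG FG; apply/funext => g.
have [[a b] gab] := arc_has_lift g.
have [ab _] := lifts_arc_lift n_gt0 gab; have gba := lifts_sym gab.
case: a b ab gab gba => i [] j ij gij gji.
- have [lt_ij|lt_ji|E] := ltgtP i j; last by case: ij; rewrite E.
    by rewrite !(frieze_peripheralP _ lt_ij gij) // !FG.
  by rewrite !(frieze_peripheralP _ lt_ji gji) // !FG.
- by rewrite (lifts_inj gij (lifts_bridging_arc i j)) FG.
- by rewrite (lifts_inj gji (lifts_bridging_arc j i)) FG.
- have [lt_ij|lt_ji|E] := ltgtP i j; last by case: ij; rewrite E.
    by rewrite !(frieze_peripheralQ _ lt_ij gij) // !FG.
  by rewrite !(frieze_peripheralQ _ lt_ji gji) // !FG.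
Qed.

End Arcs.

(** * Positive integral quasi-friezes have rank two *)

Lemma int_ind2 (P : int -> Prop) (k : int) : P k ->
  (forall i, P i -> P (i + 1)) -> (forall i, P i -> P (i - 1)) ->
  forall i, P i.
Proof.
move=> Pk up down i; rewrite -(subrKC k i).
elim: (i - k) => [|m IH|m IH]; first by rewrite addr0.
  by rewrite -addn1 PoszD addrA; apply: up.
by rewrite -addn1 PoszD opprD addrA; apply: down.
Qed.

Section Minors.
Variable u : int -> int -> int.
Hypothesis u_gt0 : forall i j, 0 < u i j.
Hypothesis diamond : forall i j : int,
  u i (j + 1) * u (i + 1) j - u (i + 1) (j + 1) * u i j = 1.

(** Opposite to the usual determinant sign, so that by [diamond] the adjacent rows [i], [i + 1] give
    1. *)
Definition minor (k i j : int) := u i (k + 1) * u j k - u j (k + 1) * u i k.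

(** Induction on [j - i]: a three-term Plücker relation, in which rows [l], [l + 1] contribute the
    minor 1, writes the next minor times a positive entry as a sum of positive terms. *)
Lemma minor_gt0 (k i j : int) : i < j -> 0 < minor k i j.
Proof.
have step l : minor k i (l + 1) * u l k = minor k i l * u (l + 1) k + u i k.
  by rewrite -[X in _ = _ + X]mulr1 -[X in _ = _ + _ * X](diamond l k) /minor; ring.
move=> ij; have -> : j = i + 1 + (absz (j - i - 1)%R)%:Z by lia.
elim: (absz _) => [|m IH]; first by rewrite addr0 /minor diamond.
rewrite -addn1 PoszD addrA -(pmulr_lgt0 _ (u_gt0 (i + 1 + m%:Z) k)) step.
by rewrite addr_gt0 ?mulr_gt0.
Qed.

(* The quotient (u_{i,k+1} + u_{i,k-1}) / u_{i,k} does not depend on i. *)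
Lemma column_recurrence k i j :
  u j k * (u i (k + 1) + u i (k - 1)) = u i k * (u j (k + 1) + u j (k - 1)).
Proof.
have step l :
  u (l + 1) k * (u l (k + 1) + u l (k - 1)) =
  u l k * (u (l + 1) (k + 1) + u (l + 1) (k - 1)).
  (* The two sides differ by the diamond at [(l, k)] minus the one at [(l, k - 1)], that is, by 1 -
     1. *)
  move: (diamond l k) (diamond l (k - 1)); rewrite subrK => E1 E2.
  apply/eqP; rewrite -subr_eq0; apply/eqP.
  by rewrite -[RHS](subrr 1) -[X in _ = X - _]E1 -[X in _ = _ - X]E2; ring.
have nz l : u l k != 0 by rewrite gt_eqF.
move: j; apply: (@int_ind2 _ i) => [//|j IH|j IH].
  apply: (mulfI (nz j)).
  transitivity (u (j + 1) k * (u j k * (u i (k + 1) + u i (k - 1)))).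
    by ring.
  by rewrite IH mulrCA step; ring.
have := step (j - 1); rewrite subrK => Ej.
apply: (mulfI (nz j)).
transitivity (u (j - 1) k * (u j k * (u i (k + 1) + u i (k - 1)))).
  by ring.
by rewrite IH mulrCA -Ej; ring.
Qed.

(** Moving by one column changes the minor by the difference of the two sides of
    [column_recurrence]. *)
Lemma minor_column k l i j : minor k i j = minor l i j.
Proof.
have step m : minor (m - 1) i j = minor m i j.
  have := column_recurrence m i j; rewrite /minor subrK => E.
  apply/eqP; rewrite -subr_eq0; apply/eqP.
  transitivity (u i m * (u j (m + 1) + u j (m - 1)) -
                u j m * (u i (m + 1) + u i (m - 1))); first by ring.
  by rewrite E subrr.
move: k; apply: (@int_ind2 _ l) => // k IH; last by rewrite step.
by rewrite -step addrK.
Qed.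

End Minors.

(** * Plane vectors attached to the lifted marked points *)

Section Vectors.
Variable u : int -> int -> int.
Hypothesis u_gt0 : forall i j, 0 < u i j.
Hypothesis diamond : forall i j : int,
  u i (j + 1) * u (i + 1) j - u (i + 1) (j + 1) * u i j = 1.

Local Notation ut := (fun i j => u j i).

Lemma ut_gt0 i j : 0 < ut i j.
Proof. exact: u_gt0. Qed.

Lemma ut_diamond i j :
  ut i (j + 1) * ut (i + 1) j - ut (i + 1) (j + 1) * ut i j = 1.
Proof. by rewrite [X in X - _]mulrC diamond. Qed.

(* The coordinates of v_{Q_j} solve u_{i,j} = det (v_{P_i}, v_{Q_j}) for i = 0
   and i = 1. *)
Definition vect (a : lpoint) : int * int :=
  match a with
  | hatP i => (u i 1, u i 0)
  | hatQ j => (minor ut 0 1 j, minor ut 0 0 j)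
  end.

Definition vdet (a b : lpoint) : int :=
  (vect a).1 * (vect b).2 - (vect a).2 * (vect b).1.

Lemma vdet_anti a b : vdet a b = - vdet b a.
Proof. by rewrite /vdet; ring. Qed.

Lemma vdet_pluecker a b c d :
  vdet a c * vdet b d = vdet a b * vdet c d + vdet b c * vdet a d.
Proof. by rewrite /vdet; ring. Qed.

Lemma vdetPP i j : vdet (hatP i) (hatP j) = minor u 0 i j.
Proof. by rewrite /vdet /minor /= add0r; ring. Qed.

(** [vect (hatQ j)] is the image of [(u 0 j, u 1 j)] under a matrix whose determinant is the diamond
    at [(0, 0)], hence 1. The swap of [j] and [k] matches the right-to-left order of the Q's. *)
Lemma vdetQQ j k : vdet (hatQ j) (hatQ k) = minor ut 0 k j.
Proof.
rewrite -[RHS]mul1r -[X in _ = X * _](diamond 0 0) /vdet /= /minor !add0r; ring.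
Qed.

(** Columns 0, 1 and [j] of [u] satisfy the same second-order recurrence in the row index, hence so
    does the error [e]. As [e] vanishes at 0 and 1 and the outer coefficient [u l 0] is nonzero, it
    vanishes in both directions. *)
Lemma vdetPQ i j : vdet (hatP i) (hatQ j) = u i j.
Proof.
pose e i := vdet (hatP i) (hatQ j) - u i j.
have rec l : u l 0 * (e (l + 1) + e (l - 1)) =
             e l * (u (l + 1) 0 + u (l - 1) 0).
  have E1 := column_recurrence ut_gt0 ut_diamond l 1 0.
  have Ej := column_recurrence ut_gt0 ut_diamond l j 0.
  rewrite /= in E1 Ej.
  rewrite /e /vdet /=; move: (minor _ _ _ _) (minor _ _ _ _) => x y.
  transitivity (u l 0 * (u (l + 1) 1 + u (l - 1) 1) * y
    - x * u l 0 * (u (l + 1) 0 + u (l - 1) 0)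
    - u l 0 * (u (l + 1) j + u (l - 1) j)); first by ring.
  by rewrite E1 Ej; ring.
have nz l : u l 0 != 0 by rewrite gt_eqF.
have e01 : e 0 = 0 /\ e 1 = 0.
  have D := diamond 0 0; rewrite !add0r in D.
  split; rewrite /e /vdet /= /minor !add0r; apply/eqP; rewrite subr_eq0;
    apply/eqP; rewrite -[RHS]mul1r -[X in _ = X * _]D; ring.
suff [] : e i = 0 /\ e (i + 1) = 0 by move=> /eqP; rewrite subr_eq0 => /eqP.
move: i; apply: (@int_ind2 _ 0) => [|l [El El1]|l [El El1]].
- by rewrite add0r.
- split=> //; have := rec (l + 1).
  rewrite addrK El El1 addr0 mul0r => /eqP.
  by rewrite mulf_eq0 (negPf (nz _)) => /eqP.
- rewrite subrK; split=> //; have := rec l.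
  rewrite El El1 add0r mul0r => /eqP.
  by rewrite mulf_eq0 (negPf (nz _)) => /eqP.
Qed.

Lemma vdet_gt0 a b : before a b -> 0 < vdet a b.
Proof.
case: a b => i [] j //= ij; rewrite ?vdetPP ?vdetPQ ?vdetQQ //.
  exact: minor_gt0.
exact: minor_gt0 ut_gt0 ut_diamond _ _ _ ij.
Qed.

(** * Exchange relation for absolute values of determinants *)

Lemma norm_vdet a b : before a b ->
  (`|vdet a b| = vdet a b) * (`|vdet b a| = vdet a b).
Proof.
by move=> /vdet_gt0 ab; rewrite [vdet b a]vdet_anti normrN gtr0_norm.
Qed.

Lemma norm_vdet_gt0 a b : a <> b -> 0 < `|vdet a b|.
Proof.
move=> ab; have /orP[lt|lt] : before a b || before b a.
- by case: a b ab => i [] j //= ij; rewrite 1?orbC -neq_lt; apply/eqP => E;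
    apply: ij; rewrite E.
- by rewrite (norm_vdet lt) vdet_gt0.
- by rewrite (norm_vdet lt) vdet_gt0.
Qed.

Lemma before_trans a b c : before a b -> before b c -> before a c.
Proof. by case: a b c => i [] j [] k //=; lia. Qed.

Lemma norm_vdet_ptolemy_before a b c d :
    before a b -> before b c -> before c d ->
  `|vdet a c| * `|vdet b d|
  = `|vdet a b| * `|vdet c d| + `|vdet b c| * `|vdet d a|.
Proof.
move=> ab bc cd; have ac := before_trans ab bc.
have bd := before_trans bc cd.
rewrite (norm_vdet ab) (norm_vdet bc) (norm_vdet cd) (norm_vdet ac).
by rewrite (norm_vdet bd) (norm_vdet (before_trans ac cd)) vdet_pluecker.
Qed.

Lemma norm_vdetC a b : `|vdet a b| = `|vdet b a|.
Proof. by rewrite vdet_anti normrN. Qed.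

Lemma cyclic4_before a b c d : cyclic4 a b c d ->
  [\/ [/\ before a b, before b c & before c d],
      [/\ before b c, before c d & before d a],
      [/\ before c d, before d a & before a b]
    | [/\ before d a, before a b & before b c]].
Proof.
move=> abcd; have : [|| [&& before a b, before b c & before c d],
      [&& before b c, before c d & before d a],
      [&& before c d, before d a & before a b]
    | [&& before d a, before a b & before b c]].
  move: abcd; rewrite /cyclic4 /cyclic3.
  by case: a b c d => a [] b [] c [] d //=; lia.
by case/or4P=> /and3P[]; [constructor 1|constructor 2|constructor 3|constructor 4].
Qed.

(** Absolute values make the determinant symmetric, so the relation is invariant under rotating the
    four points, and some rotation is increasing for [before]. *)
Lemma norm_vdet_ptolemy a b c d : cyclic4 a b c d ->
  `|vdet a c| * `|vdet b d|
  = `|vdet a b| * `|vdet c d| + `|vdet b c| * `|vdet d a|.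
Proof.
case/cyclic4_before=> [] [x y z]; have := norm_vdet_ptolemy_before x y z => // E.
- by rewrite (norm_vdetC a c) mulrC E; ring.
- by rewrite (norm_vdetC a c) (norm_vdetC b d) E; ring.
- by rewrite (norm_vdetC b d) mulrC E; ring.
Qed.

(** * Deck invariance and the frieze of a periodic family *)

Section Periodic.
Variable n : nat.
Hypothesis u_per : forall i j, u (i + n%:Z) (j + n%:Z) = u i j.

Lemma periodic_iter k i j : u (i + k * n%:Z) (j + k * n%:Z) = u i j.
Proof.
move: k; apply: (@int_ind2 _ 0) => [|k <-|k <-]; first by rewrite mul0r !addr0.
  by rewrite mulrDl mul1r !addrA u_per.
by rewrite -[LHS]u_per mulrBl mul1r !addrA !subrK.
Qed.

(** For two points on the same line, independence of the minor from its columns (or rows) lets both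
    indices shift by [k * n], where periodicity applies. *)
Lemma vdet_deck k a b : vdet (deck n k a) (deck n k b) = vdet a b.
Proof.
have PQ i j :
    vdet (deck n k (hatP i)) (deck n k (hatQ j)) = vdet (hatP i) (hatQ j).
  by rewrite !vdetPQ periodic_iter.
case: a b => i [] j //.
- rewrite !vdetPP (minor_column u_gt0 diamond 0 (0 + k * n%:Z)).
  by rewrite /minor addrAC !periodic_iter.
- by rewrite vdet_anti PQ -vdet_anti.
- rewrite !vdetQQ (minor_column ut_gt0 ut_diamond 0 (0 + k * n%:Z)).
  by rewrite /minor addrAC !periodic_iter.
Qed.

Lemma norm_vdet_all_lifts a b c d : all_lifts n a b (c, d) ->
  `|vdet c d| = `|vdet a b|.
Proof.
by move=> [k [] [-> ->]]; rewrite vdet_deck // norm_vdetC.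
Qed.

(** An arc has no preferred lift, so one is chosen; the absolute value removes its orientation. *)
Definition vdet_frieze (g : annulus_arc n) : int :=
  let e := sval (cid (arc_has_lift g)) in `|vdet e.1 e.2|.

Lemma vdet_friezeE (g : annulus_arc n) a b :
  lifts g (a, b) -> vdet_frieze g = `|vdet a b|.
Proof.
rewrite /vdet_frieze; case: (cid _) => -[c d] gcd gab /=.
by apply: norm_vdet_all_lifts; rewrite -(liftsE gab).
Qed.

Lemma vdet_frieze_bridging i j : vdet_frieze (bridging_arc n i j) = u i j.
Proof.
by rewrite (vdet_friezeE (lifts_bridging_arc n i j)) vdetPQ gtr0_norm.
Qed.

Lemma vdet_frieze_positive_integral : (0 < n)%N ->
  positive_integral_frieze vdet_frieze.
Proof.
move=> n_gt0; split.
- move=> g; have [[a b] gab] := arc_has_lift g.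
  rewrite (vdet_friezeE gab) norm_vdet_gt0 //.
  by case: (lifts_arc_lift n_gt0 gab).
- move=> g [i] [] /vdet_friezeE ->.
    by rewrite vdetPP /minor diamond.
  (* On the boundary of the strip [hatQ (i + 1)] precedes [hatQ i], hence the reversal. *)
  by rewrite norm_vdetC vdetQQ /minor ut_diamond.
- move=> A B C D AB BC CD DA AC BD [cyc [lAB lBC lCD lDA] _] lAC lBD.
  rewrite (vdet_friezeE lAB) (vdet_friezeE lBC) (vdet_friezeE lCD).
  rewrite (vdet_friezeE lDA) (vdet_friezeE lAC) (vdet_friezeE lBD).
  exact: norm_vdet_ptolemy.
Qed.

End Periodic.
End Vectors.

Theorem theorem3p5 (R : realType) (n : nat) (n_gt0 : (0 < n)%N) :
  set_bij
    [set F : annulus_arc n -> int | positive_integral_frieze F]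
    [set u : int -> int -> R |
      [/\ quasi_frieze u, positive_integral u & periodic n u]]
    (@bridging_family R n).
Proof.
split.
- move=> F /= frF; split=> [i j|i j|i j]; rewrite /bridging_family.
  + rewrite -!intrM -intrB -[RHS](intrN R 1); congr (_%:~R).
    by rewrite -[X in _ = - X](frieze_diamond n_gt0 frF i j); ring.
  + by split; [exact: intr_int | rewrite ltr0z; case: frF].
  (* The inverse deck generator takes [(i + n, j + n)] back to [(i, j)]. *)
  + congr (F _)%:~R; apply/bridging_arc_eqP; exists (-1).
    by rewrite !mulN1r !addrK.
- move=> F G /set_mem frF /set_mem frG FG.
  apply: (frieze_inj n_gt0 frF frG) => i j.
  by have /(congr1 (fun u => u i j)) := FG; rewrite /bridging_family => /intr_inj.
(* The real entries are integers, so [floor] transfers the family to [int] without loss. *)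
- move=> u /= [diam pos per]; pose v i j := Num.floor (u i j).
  have uv i j : u i j = (v i j)%:~R by rewrite floorK //; case: (pos i j).
  have v_gt0 i j : 0 < v i j by rewrite -(ltr0z R) -uv; case: (pos i j).
  have v_diamond i j :
      v i (j + 1) * v (i + 1) j - v (i + 1) (j + 1) * v i j = 1.
    apply: (@intr_inj R); rewrite intrB !intrM -!uv.
    by rewrite -[RHS]opprK -[X in _ = - X](diam i j); ring.
  have v_per i j : v (i + n%:Z) (j + n%:Z) = v i j by rewrite /v per.
  exists (vdet_frieze v (n := n)); first exact: vdet_frieze_positive_integral.
  apply/funext => i; apply/funext => j.
  by rewrite /bridging_family vdet_frieze_bridging.
Qed.
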